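(* For every integer $j$, every $n\ge0$ and every $m\in\{0,1,2,3,4\}$: (i) $\bar P_j(m,5,5n)=\tfrac15\bar p_j(5n)$ if $j\equiv1,2\pmod5$; (ii) $\bar P_j(m,5,5n+1)=\tfrac15\bar p_j(5n+1)$ if $j\not\equiv1,2\pmod5$; (iii) $\bar P_j(m,5,5n+2)=\tfrac15\bar p_j(5n+2)$ if $j\not\equiv0,3\pmod5$; (iv) $\bar P_j(m,5,5n+3)=\tfrac15\bar p_j(5n+3)$ if $j\equiv0,3\pmod5$; (v) $\bar P_j(m,5,5n+4)=\tfrac15\bar p_j(5n+4)$ for all $j$.
   Context: For a partition $\pi=(\lambda_1\ge\cdots\ge\lambda_\nu>0)$, $\mathrm{BG\text{-}rank}(\pi)=\sum_{j=1}^{\nu}(-1)^{j+1}\mathrm{par}(\lambda_j)$, where $\mathrm{par}(m)=1$ if $m$ is odd and $0$ if $m$ is even. $\nu(\pi)$ denotes the number of parts. 2-quotient: for $\pi$ let $S=\{\lambda_j-j:j\ge1\}$ (with $\lambda_j=0$ for $j>\nu$), $S_c=\{k\in\mathbb Z:2k+c\in S\}$ for $c=0,1$, and let $\hat\pi_c$ be the partition whose parts are the numbers $\#\{s\in S_c:s>g\}$ for $g\in\mathbb Z\setminus S_c$ (finitely many positive). $\text{2-quotient-rank}(\pi)=\nu(\hat\pi_0)-\nu(\hat\pi_1)$. $\bar p_j(n)$ is the number of partitions of $n$ with BG-rank equal to $j$, and $\bar P_j(m,5,n)$ is the number of partitions of $n$ with BG-rank equal to $j$ and 2-quotient-rank $\equiv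 m\pmod5$. *)

(* Defs.v *)
From mathcomp Require Import all_boot all_order all_algebra.
From mathcomp Require Import boolp.
Set Implicit Arguments. Unset Strict Implicit. Unset Printing Implicit Defensive.
Import Order.TTheory GRing.Theory Num.Theory.
Local Open Scope ring_scope.

Definition lam (p : seq nat) (j : nat) : nat := nth 0%N p j.-1.

Definition par (m : nat) : int := (odd m)%:Z.

Definition BG_rank (p : seq nat) : int :=
  \sum_(1 <= j < (size p).+1) (-1) ^+ j.+1 * par (lam p j).

Definition inS (p : seq nat) (x : int) : Prop :=
  exists j : nat, (1 <= j)%N /\ x = (lam p j)%:Z - j%:Z.

Definition inSc (p : seq nat) (c : int) (k : int) : Prop := inS p (2 * k + c).

(* nu(hat pi_c) = N : the number of g in Z \ S_c for which the part
   #{ s in S_c : s > g } is positive is exactly N. *)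
Definition nu_hat_is (p : seq nat) (c : int) (N : nat) : Prop :=
  exists s : seq int,
    [/\ uniq s,
        forall g : int, g \in s <-> (~ inSc p c g /\ exists t, inSc p c t /\ g < t)
      & size s = N].

Definition two_quot_rank_is (p : seq nat) (r : int) : Prop :=
  exists N0 N1 : nat, [/\ nu_hat_is p 0 N0, nu_hat_is p 1 N1 & r = N0%:Z - N1%:Z].

(* Partitions of n are enumerated as f : 'I_n -> 'I_(n+1) giving
   (lambda_1, ..., lambda_n) padded with zeros; valid iff nonincreasing with sum n.
   The parts of the partition are the positive values. *)
Definition fvals (n : nat) (f : {ffun 'I_n -> 'I_n.+1}) : seq nat :=
  [seq (val (f i)) | i <- enum 'I_n].

Definition parts_of (n : nat) (f : {ffun 'I_n -> 'I_n.+1}) : seq nat :=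
  [seq x <- fvals f | (0 < x)%N].

Definition is_part_code (n : nat) (f : {ffun 'I_n -> 'I_n.+1}) : bool :=
  sorted geq (fvals f) && (sumn (fvals f) == n).

Definition pbar (j : int) (n : nat) : nat :=
  #|[set f : {ffun 'I_n -> 'I_n.+1} | is_part_code f && (BG_rank (parts_of f) == j)]|.

Definition Pbar5 (j : int) (m : nat) (n : nat) : nat :=
  #|[set f : {ffun 'I_n -> 'I_n.+1} | [&& is_part_code f,
        BG_rank (parts_of f) == j &
        `[< exists r : int, two_quot_rank_is (parts_of f) r /\ (r = m%:Z %[mod 5])%Z >]]]|.

(* Main.v *)
(* The beta-set X = {lambda_j - j + 2M : 1 <= j <= 2M} of a partition of n splits
   by parity into X_0 and X_1.  The BG-rank j is read off the cardinals
   |X_0| = M + j and |X_1| = M - j, and nu(hat pi_c) is the number of gaps of X_c,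
   so a fifth root of unity z <> 1 gives
     sum_pi z^(nu(hat pi_0) - nu(hat pi_1)) = [q^N] 1 / ((zq;q)(q/z;q)),
   where n = 2N + 2j^2 - j.  Multiplying the right-hand series by (q^5;q^5) turns it
   into (q;q)(z^2 q;q)(z^-2 q;q), which by the Jacobi triple product is supported on
   exponents m(m-1)/2, with cancellation of m against 1-m when m = 3 mod 5; hence the
   coefficients with N = 2, 3, 4 mod 5 vanish.  The congruences of the theorem are
   exactly those forcing N into these classes, and summing over the powers of a
   primitive root isolates each residue class of the rank. *)
Require Import Defs.
From mathcomp Require Import all_boot all_order all_algebra.
From mathcomp Require Import algC cyclotomic boolp.
From mathcomp Require Import zify ring.
Set Implicit Arguments. Unset Strict Implicit. Unset Printing Implicit Defensive.
Import Order.TTheory GRing.Theory Num.Theory.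
Local Open Scope ring_scope.

(** * Polynomials modulo X^T, standing in for truncated power series *)

Definition eqX (R : comNzRingType) (T : nat) (p q : {poly R}) : Prop :=
  exists r, p = q + 'X^T * r.

Section EqX.
Variable R : comNzRingType.
Implicit Types p q r : {poly R}.

Lemma eqX_refl T p : eqX T p p.
Proof. by exists 0; rewrite mulr0 addr0. Qed.

Lemma eqX_sym T p q : eqX T p q -> eqX T q p.
Proof. by case=> r ->; exists (- r); ring. Qed.

Lemma eqX_trans T p q r : eqX T p q -> eqX T q r -> eqX T p r.
Proof. by case=> s -> [t ->]; exists (s + t); ring. Qed.

Lemma eqX_add T p q p' q' : eqX T p q -> eqX T p' q' -> eqX T (p + p') (q + q').
Proof. by case=> r -> [s ->]; exists (r + s); ring. Qed.

Lemma eqX_mul T p q p' q' : eqX T p q -> eqX T p' q' -> eqX T (p * p') (q * q').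
Proof. by case=> r -> [s ->]; exists (r * q' + q * s + 'X^T * r * s); ring. Qed.

Lemma eqX_le T T' p q : (T' <= T)%N -> eqX T p q -> eqX T' p q.
Proof.
move=> le [r ->]; exists ('X^(T - T') * r).
by rewrite mulrA -exprD subnKC.
Qed.

Lemma eqX_mulXn T m p q : eqX T p q -> eqX (m + T) ('X^m * p) ('X^m * q).
Proof. by case=> r ->; exists r; rewrite exprD; ring. Qed.

Lemma eqX_coef T p q i : eqX T p q -> (i < T)%N -> p`_i = q`_i.
Proof. by case=> r -> lt; rewrite coefD coefXnM lt addr0. Qed.

(** A polynomial 1 + X s is invertible modulo X^T: the truncated geometric series in -X s is an
    inverse. *)
Lemma eqX_cancel T p q r :
  r`_0 = 1 -> eqX T (r * p) (r * q) -> eqX T p q.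
Proof.
move=> r0 e.
have [s rE] : exists s, r = 1 + 'X * s.
  exists (drop_poly 1 r); rewrite -{1}(poly_take_drop 1 r) mulrC expr1.
  congr (_ + _); apply/polyP=> i; rewrite coef_take_poly coef1.
  by case: i.
have [v vE] : exists v, eqX T (v * r) 1.
  exists (\sum_(i < T) (- ('X * s)) ^+ i).
  exists (- (- s) ^+ T).
  have := subrX1 (- ('X * s)) T => h.
  have -> : r = - (- ('X * s) - 1) by rewrite rE; ring.
  by rewrite mulrN mulrC -h exprNn exprMn [(- s) ^+ T]exprNn; ring.
have sub t : eqX T t (v * (r * t)).
  rewrite mulrA -{1}[t]mul1r; apply: eqX_mul (eqX_refl _ _).
  exact: eqX_sym.
apply: eqX_trans (sub p) _; apply: eqX_trans (eqX_sym (sub q)).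
exact: eqX_mul (eqX_refl _ _) e.
Qed.

End EqX.

(** * q-Pochhammer products and Gaussian binomials, with q = X *)

Section QPochhammer.
Variable R : comNzRingType.
Implicit Type z : R.

(** This is (zq; q)_A: the exponents start at 1. *)
Definition qpoch z (A : nat) : {poly R} := \prod_(k < A) (1 - z%:P * 'X^(k.+1)).

Lemma qpochS z A : qpoch z A.+1 = qpoch z A * (1 - z%:P * 'X^(A.+1)).
Proof. exact: big_ord_recr. Qed.

Lemma qpoch_stable z A B : (A <= B)%N -> eqX A.+1 (qpoch z B) (qpoch z A).
Proof.
elim: B => [|B IH]; first by rewrite leqn0 => /eqP->; apply: eqX_refl.
rewrite leq_eqVlt => /predU1P[->|le]; first exact: eqX_refl.
rewrite qpochS -[qpoch z A]mulr1; apply: eqX_mul; first exact: IH.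
by apply: eqX_le (_ : eqX B.+1 _ _) => //; exists (- z%:P); ring.
Qed.

Lemma qpoch_coef0 z A : (qpoch z A)`_0 = 1.
Proof.
rewrite (eqX_coef (qpoch_stable z (leq0n A))) //.
by rewrite /qpoch big_ord0 coef1.
Qed.

(** Gaussian binomials, given by a q-Pascal rule so that no polynomial division occurs. *)
Fixpoint qbin (n k : nat) : {poly R} :=
  match n, k with
  | _, 0 => 1
  | 0, _.+1 => 0
  | n'.+1, k'.+1 => qbin n' k'.+1 + 'X^(n' - k') * qbin n' k'
  end.

Lemma qbin0 n : qbin n 0 = 1. Proof. by case: n. Qed.

Lemma qbin_small n k : (n < k)%N -> qbin n k = 0.
Proof.
elim: n k => [|n IH] [|k] //= lt.
by rewrite !IH ?mulr0 ?addr0 //; lia.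
Qed.

(** Being homogeneous in [a] and [b], this form lets [a] be a power of X, which later replaces
    negative powers. *)
Lemma qbin_theorem (a b : {poly R}) n :
  \prod_(i < n) (a + b * 'X^i) =
  \sum_(k < n.+1) 'X^('C(k, 2)) * qbin n k * b ^+ k * a ^+ (n - k).
Proof.
elim: n => [|n IH].
  by rewrite big_ord0 big_ord1 /= !expr0 !mulr1.
rewrite big_ord_recr /= IH mulrDr !big_distrl /=.
rewrite [RHS]big_ord_recl /= [in RHS]/bump /=.
(* The term i = 0 splits off, and the new top term vanishes because [qbin n n.+1] is 0. *)
have -> : \sum_(i < n.+1) 'X^('C(i, 2)) * qbin n i * b ^+ i * a ^+ (n - i) * a =
   a ^+ n.+1 +
   \sum_(i < n.+1) 'X^('C(i.+1, 2)) * qbin n i.+1 * b ^+ i.+1 * a ^+ (n - i).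
  rewrite big_ord_recl big_ord_recr /= (@qbin_small n n.+1) // qbin0 !mulr0 !mul0r addr0.
  congr (_ + _); first by rewrite !expr0 subn0 exprSr; ring.
  apply: eq_bigr => i _; rewrite /bump /= add1n.
  rewrite -[LHS]mulrA -exprSr; congr (_ * _ ^+ _); have := ltn_ord i; lia.
rewrite -addrA -big_split /=; congr (_ + _).
  by rewrite !expr0 subn0 !mul1r.
apply: eq_bigr => i _; rewrite add1n subSS binS bin1 exprSr.
rewrite add0n.
have {1}-> : 'X^n = 'X^i * 'X^(n - i) :> {poly R}.
  by rewrite -exprD subnKC // -ltnS.
by rewrite addnC exprD; ring.
Qed.

(** In the inductive step the two Pascal terms contribute 1 - X^(n-k) and X^(n-k) (1 - X^(k+1)),
    whose sum is 1 - X^(n+1). *)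
Lemma qbin_qpoch n k : (k <= n)%N ->
  qbin n k * qpoch 1 k * qpoch 1 (n - k) = qpoch 1 n.
Proof.
elim: n k => [|n IH] [|k] // le.
- by rewrite /qpoch big_ord0 /= !mulr1.
- by rewrite subn0 /qpoch big_ord0 /= !mul1r.
rewrite subSS /=; move: le; rewrite ltnS leq_eqVlt => /predU1P[->|lt].
  by rewrite qbin_small // subnn [in RHS]qpochS -(IH n) // subnn qpochS expr0 polyC1; ring.
have e : (n - k = (n - k.+1).+1)%N by lia.
rewrite mulrDl mulrDl.
have -> : qbin n k.+1 * qpoch 1 k.+1 * qpoch 1 (n - k)
        = qpoch 1 n * (1 - 'X^(n - k)).
  by rewrite -(IH k.+1) // e [qpoch 1 (n - k.+1).+1]qpochS polyC1 mul1r; ring.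
have -> : 'X^(n - k) * qbin n k * qpoch 1 k.+1 * qpoch 1 (n - k)
        = qpoch 1 n * ('X^(n - k) * (1 - 'X^(k.+1))).
  by rewrite -(IH k) ?qpochS ?polyC1; [ring | lia].
rewrite qpochS polyC1.
have -> : 'X^(n.+1) = 'X^(n - k) * 'X^(k.+1) :> {poly R} by rewrite -exprD; congr (_ ^+ _); lia.
by ring.
Qed.

(* (q)_A [2A+1, k] is 1 to high order: (q)_l (q)_(2A+1-l) [2A+1, k] = (q)_(2A+1)
   with l the smaller of k and 2A+1-k, and all of (q)_l, (q)_(2A+1-l), (q)_A and
   (q)_(2A+1) agree to order l. *)
Lemma qbin_trunc A k : (k <= A.*2.+1)%N ->
  eqX (minn k (A.*2.+1 - k)).+1 (qpoch 1 A * qbin A.*2.+1 k) 1.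
Proof.
set l := minn _ _ => le.
have lA : (l <= A)%N by rewrite /l; lia.
apply: (@eqX_cancel _ _ _ _ (qpoch 1 l)); first exact: qpoch_coef0.
pose h := (A.*2.+1 - l)%N.
have key : qbin A.*2.+1 k * qpoch 1 l * qpoch 1 h = qpoch 1 A.*2.+1.
  rewrite -(qbin_qpoch le) /h /l; case: leqP => c //.
  by rewrite subKn // mulrAC.
have S m : (l <= m)%N -> eqX l.+1 (qpoch 1 m) (qpoch 1 l) by exact: qpoch_stable.
apply: (@eqX_trans _ _ _ (qpoch 1 l * (qpoch 1 h * qbin A.*2.+1 k))).
  apply: eqX_mul (eqX_refl _ _) (eqX_mul _ (eqX_refl _ _)).
  apply: eqX_trans (S _ lA) (eqX_sym (S _ _)); rewrite /h; lia.
have -> : qpoch 1 l * (qpoch 1 h * qbin A.*2.+1 k) = qpoch 1 A.*2.+1.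
  by rewrite -key; ring.
by rewrite mulr1; apply: S; lia.
Qed.

End QPochhammer.

(** * Exponents of the theta series *)

Lemma bin2_mod5 m : ('C(m, 2) %% 5 \in [:: 2; 3; 4] -> m %% 5 = 3)%N.
Proof.
rewrite bin2 => h.
have e : ((m * m.-1)./2.*2 = m * m.-1)%N.
  by apply: even_halfK; rewrite oddM; case: m {h} => //= m; rewrite andNb.
move: h e; set c := _./2 => h e.
(* Here [m + 4] stands for m - 1 modulo 5; what remains is a finite check on residues. *)
have e5 : (c.*2 %% 5 = ((m %% 5) * ((m + 4) %% 5)) %% 5)%N.
  by rewrite e modnMm; case: (m) => // k; rewrite -modnMmr -[in RHS]modnMmr addSnnS modnDr.
have -> : (m %% 5 = 3)%N <-> (m %% 5 == 3)%N by split=> [->|/eqP].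
move: h e5; rewrite -muln2 -modnMml -[((m + 4) %% 5)%N]modnDml.
have := ltn_pmod m (isT : (0 < 5)%N); have := ltn_pmod c (isT : (0 < 5)%N).
move: (m %% 5)%N (c %% 5)%N => a b.
by case: b => [|[|[|[|[|b]]]]] //; case: a => [|[|[|[|[|a]]]]].
Qed.

(* Writing k = A + d, this is d(d-1)/2, for d of either sign. *)
Definition theta_exp (A k : nat) : nat :=
  if (A <= k)%N then 'C(k - A, 2) else 'C(A.+1 - k, 2).

Lemma bin2_add k d : ('C(k + d, 2) = 'C(k, 2) + k * d + 'C(d, 2))%N.
Proof.
elim: d => [|d IH]; first by rewrite bin0n !addn0 muln0 addn0.
by rewrite addnS !binS IH !bin1; lia.
Qed.

(** Completing the square: the left side is the exponent of X in term k of the q-binomial theorem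
    with a = X^A and n = 2A + 1. *)
Lemma theta_expE A k : (k <= A.*2.+1)%N ->
  ('C(k, 2) + A * (A.*2.+1 - k) = 'C(A, 2) + A * A.+1 + theta_exp A k)%N.
Proof.
rewrite /theta_exp => le; case: leqP => c.
  have [d dE] : exists d, (k = A + d)%N by exists (k - A)%N; lia.
  rewrite {}dE in le c *; rewrite bin2_add.
  have -> : (A + d - A = d)%N by lia.
  have -> : (A.*2.+1 - (A + d) = A.+1 - d)%N by lia.
  nia.
have [d dE] : exists d, (A = k + d)%N by exists (A - k)%N; lia.
rewrite {}dE in le c *; rewrite bin2_add.
have -> : ((k + d).+1 - k = d.+1)%N by lia.
have -> : ((k + d).*2.+1 - k = k + d + d.+1)%N by lia.
rewrite binS bin1.
have := bin2_add d d; rewrite addnn.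
have e : ('C(d, 2).*2 + d = d * d)%N.
  elim: (d) => // n IH; rewrite binS bin1; nia.
nia.
Qed.

(** * The finite Jacobi triple product and its vanishing coefficients *)

Section Jacobi.
Variables (F : fieldType) (z : F).
Hypotheses (z5 : z ^+ 5 = 1) (z1 : z != 1).

(* Left-hand side of the q-binomial theorem with a = X^A and b = -z, n = 2A+1: a
   truncated Jacobi triple product without negative powers of X. *)
Lemma qpoch_theta A :
  \prod_(i < A.*2.+1) ('X^A + (- z)%:P * 'X^i) =
  ((- z) ^+ A * (1 - z))%:P * 'X^('C(A, 2) + A * A.+1)
   * (qpoch z A * qpoch (z ^+ 4) A).
Proof.
have e : (A.*2.+1 = A + A.+1)%N by rewrite addnS addnn.
rewrite e big_split_ord /=.
(* For i < A the factor is -z X^i (1 - z^4 X^(A-i)), as z^4 is the inverse of z. *)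
have -> : \prod_(i < A) ('X^A + (- z)%:P * 'X^i) =
   ((- z) ^+ A)%:P * 'X^('C(A, 2)) * qpoch (z ^+ 4) A.
  have -> : 'C(A, 2) = (\sum_(i < A) i)%N by rewrite -bin2_sum big_mkord.
  have -> : 'X^(\sum_(i < A) i) = \prod_(i < A) 'X^i :> {poly F}.
    by apply: (big_morph (fun i => 'X^i)) => [a b|]; rewrite ?exprD ?expr0.
  have -> : ((- z) ^+ A)%:P = \prod_(i < A) (- z)%:P :> {poly F}.
    by rewrite prodr_const card_ord polyC_exp.
  rewrite /qpoch [X in _ * X](reindex_inj rev_ord_inj) -!big_split /=.
  apply: eq_bigr => i _.
  have -> : 'X^A = 'X^i * 'X^((A - i.+1).+1) :> {poly F}.
    by rewrite -exprD; congr (_ ^+ _); have := ltn_ord i; lia.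
  have -> : (z ^+ 4)%:P = z%:P ^+ 4 by rewrite polyC_exp.
  have zz : z%:P ^+ 5 = 1 :> {poly F} by rewrite -polyC_exp z5.
  rewrite polyCN.
  transitivity (z%:P ^+ 5 * 'X^i * 'X^((A - i.+1).+1) - z%:P * 'X^i : {poly F}).
    by rewrite zz mul1r mulNr.
  by ring.
(* The factor i = A is X^A (1 - z); each later one is X^A (1 - z X^(i-A)). *)
rewrite exprD polyCM big_ord_recl /= addn0.
have -> : \prod_(i < A) ('X^A + (- z)%:P * 'X^(A + bump 0 i)) =
   'X^(A * A) * qpoch z A.
  have -> : 'X^(A * A) = \prod_(i < A) 'X^A :> {poly F}.
    by rewrite prodr_const card_ord exprM.
  rewrite -big_split /=; apply: eq_bigr => i _.
  by rewrite /bump add1n exprD polyCN; ring.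
by rewrite mulnS exprD polyCN polyCB; ring.
Qed.

Hypothesis charF : (2%:R : F) != 0.

Lemma theta_coef A N : (N < A)%N -> (N %% 5 \in [:: 2; 3; 4])%N ->
  (qpoch 1 A * qpoch z A * qpoch (z ^+ 4) A)`_N = 0.
Proof.
move=> ltNA N5.
have z0 : z != 0.
  by apply: contra_eq_neq z5 => ->; rewrite expr0n eq_sym oner_eq0.
pose e1 := ('C(A, 2) + A * A.+1)%N; pose c := (- z) ^+ A * (1 - z).
have c0 : c != 0 by rewrite mulf_neq0 ?expf_neq0 ?oppr_eq0 // subr_eq0 eq_sym.
apply: (mulfI c0); rewrite mulr0.
have := congr1 (fun p => (qpoch 1 A * p)`_(e1 + N)) (qpoch_theta A).
rewrite {1}qbin_theorem -/e1 -/c.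
have -> : qpoch 1 A * (c%:P * 'X^e1 * (qpoch z A * qpoch (z ^+ 4) A))
  = c%:P * ('X^e1 * (qpoch 1 A * qpoch z A * qpoch (z ^+ 4) A)) by ring.
rewrite coefCM coefXnM ltnNge leq_addr /= addKn => <-.
rewrite big_distrr /= coef_sum.
(* Multiplied by (q)_A, each Gaussian binomial is 1 to sufficient order, so term k contributes
   (-z)^k exactly when its theta exponent is N. *)
pose f (k : nat) : F := (- z) ^+ k *+ (theta_exp A k == N).
rewrite (eq_bigr (fun k : 'I_A.*2.+2 => f k)) => [|k _]; last first.
  have le : (k <= A.*2.+1)%N by rewrite -ltnS.
  have -> : qpoch 1 A * ('X^('C(k, 2)) * qbin F A.*2.+1 k * (- z)%:P ^+ k
     * 'X^A ^+ (A.*2.+1 - k)) =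
     ((- z) ^+ k)%:P * ('X^e1 * ('X^(theta_exp A k) * (qpoch 1 A * qbin F A.*2.+1 k))).
    rewrite -exprM polyC_exp.
    transitivity ('X^('C(k, 2) + A * (A.*2.+1 - k)) * (- z)%:P ^+ k *
      (qpoch 1 A * qbin F A.*2.+1 k)); first by rewrite exprD; ring.
    by rewrite theta_expE // exprD; ring.
  rewrite coefCM coefXnM ltnNge leq_addr /= addKn coefXnM /f.
  case: ltnP => ltN; first by rewrite mulr0 gtn_eqF.
  rewrite (eqX_coef (qbin_trunc _ le)).
    by rewrite coef1 subn_eq0 mulr_natr eqn_leq ltN.
  rewrite /theta_exp in ltN *.
  (* The truncation order falls as k moves away from A, while the theta exponent grows; this bound,
     with N < A, keeps N - [theta_exp A k] below that order. *)
  have h m : (m <= 'C(m, 2) + 2)%N.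
    by elim: m => // m IH; rewrite binS bin1; case: (m) IH => // m'; lia.
  case: (leqP A k) ltN => ck ltN; [have := h (k - A)%N | have := h (A.+1 - k)%N]; lia.
pose S := \sum_(k < A.*2.+2) f k.
(* Adding the sum to its reversal pairs k with 2A + 1 - k. These have equal exponents and opposite
   parities, so opposite signs. *)
suff : S *+ 2 = 0.
  by rewrite -mulr_natr => /eqP; rewrite mulf_eq0 (negPf charF) orbF => /eqP.
rewrite mulr2n {2}/S (reindex_inj rev_ord_inj) -big_split /=.
apply: big1 => k _; have le : (k <= A.*2.+1)%N by rewrite -ltnS.
rewrite subSS /f.
have tE : theta_exp A (A.*2.+1 - k) = theta_exp A k.
  rewrite /theta_exp.
  have [c1|c1] := leqP A k; have [c2|c2] := leqP A (A.*2.+1 - k).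
  - have [->|->] : k = A :> nat \/ k = A.+1 :> nat by lia.
      by rewrite subnn; have -> : (A.*2.+1 - A - A = 1)%N by lia.
    by rewrite subSnn; have -> : (A.*2.+1 - A.+1 - A = 0)%N by lia.
  - by congr binomial; lia.
  - by congr binomial; lia.
  - by lia.
rewrite tE; case: eqP => [tN|_]; last by rewrite !mulr0n addr0.
rewrite !mulr1n.
(* The class of N forces d = k - A to be 3 modulo 5, the fixed point of d -> 1 - d, so both powers
   of z agree. *)
have k5 : (k = A.*2.+1 - k %[mod 5])%N.
  rewrite -tN /theta_exp in N5.
  by case: leqP N5 => c1 /bin2_mod5; lia.
rewrite exprNn [X in _ + X]exprNn.
have zk i : z ^+ i = z ^+ (i %% 5).
  by rewrite {1}(divn_eq i 5) exprD mulnC exprM z5 expr1n mul1r.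
rewrite [z ^+ k]zk [X in _ + _ * X]zk k5 -mulrDl.
rewrite -signr_odd -[(-1) ^+ (_ - _)]signr_odd oddB // /= odd_double /=.
by case: (odd k); rewrite /= ?expr0 ?expr1 ?addNr ?subrr mul0r.
Qed.

End Jacobi.

(** * Dissection by a fifth root of unity *)

Section FifthRoot.
Variables (F : fieldType) (z : F).
Hypotheses (z5 : z ^+ 5 = 1) (z1 : z != 1).

Lemma sum_fifth_root : 1 + z + z ^+ 2 + z ^+ 3 + z ^+ 4 = 0.
Proof.
have z1' : z - 1 != 0 by rewrite subr_eq0.
apply: (mulfI z1'); rewrite mulr0.
by transitivity (z ^+ 5 - 1); [ring | rewrite z5 subrr].
Qed.

(** Factorwise, the product of 1 - w x over all fifth roots of unity w is 1 - x^5. The grouping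
    isolates the triple product for z^2, since z^8 = z^3 is the inverse of z^2. *)
Lemma qpoch_fifth_roots A :
  qpoch 1 A * qpoch (z ^+ 2) A * qpoch ((z ^+ 2) ^+ 4) A *
    (qpoch z A * qpoch (z ^+ 4) A) = qpoch 1 A \Po 'X^5.
Proof.
rewrite /qpoch.
rewrite [RHS](big_morph (fun p => p \Po 'X^5) (fun p q => comp_polyM p q _) (comp_polyC _ _)).
rewrite -!big_split /=; apply: eq_bigr => k _.
rewrite comp_polyB polyC1 mul1r comp_polyC comp_Xn_poly ['X^5 ^+ _]exprAC.
set x := 'X^(k.+1); set y := z%:P.
have y5 : y ^+ 5 = 1 by rewrite /y -polyC_exp z5.
have ys : 1 + y + y ^+ 2 + y ^+ 3 + y ^+ 4 = 0.
  by rewrite /y -!polyC_exp -!polyCD sum_fifth_root.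
have -> : ((z ^+ 2) ^+ 4)%:P = y ^+ 3.
  by rewrite -exprM -[(2 * 4)%N]/(5 + 3)%N exprD z5 mul1r polyC_exp.
rewrite !polyC_exp -/y.
(* Inverse roots are paired; s = y + y^4 satisfies s^2 = 1 - s, and the other pair has sum -1 -
   s. *)
transitivity ((1 - x) * (1 - (y + y ^+ 4) * x + y ^+ 5 * x ^+ 2)
  * (1 - (y ^+ 2 + y ^+ 3) * x + y ^+ 5 * x ^+ 2)); first by ring.
rewrite y5.
have -> : y ^+ 2 + y ^+ 3 = - 1 - (y + y ^+ 4).
  by apply/eqP; rewrite -subr_eq0; apply/eqP; rewrite -[RHS]ys; ring.
have s2 : (y + y ^+ 4) ^+ 2 = 1 - (y + y ^+ 4).
  transitivity (y ^+ 2 + 2%:R * y ^+ 5 + y ^+ 5 * y ^+ 3); first by ring.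
  rewrite y5; apply/eqP; rewrite -subr_eq0; apply/eqP; rewrite -[RHS]ys; ring.
move: (y + y ^+ 4) s2 => s s2.
transitivity ((1 - x) * (1 + x + (2%:R - s - s ^+ 2) * x ^+ 2 + x ^+ 3 + x ^+ 4)).
  by ring.
by rewrite s2; ring.
Qed.

Hypothesis charF : (2%:R : F) != 0.

(** Multiplying [p] by (q^5; q^5)_A gives the triple product for z^2. That multiplier has constant
    term 1 and only exponents divisible by 5, so induction on N stays inside one residue class. *)
Lemma birank_coef A N (p : {poly F}) :
  eqX A (qpoch z A * qpoch (z ^+ 4) A * p) 1 ->
  (N < A)%N -> (N %% 5 \in [:: 2; 3; 4])%N -> p`_N = 0.
Proof.
move=> pE; elim/ltn_ind: N => N IH ltNA N5.
have zz5 : (z ^+ 2) ^+ 5 = 1 by rewrite -exprM mulnC exprM z5 expr1n.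
have zz1 : z ^+ 2 != 1.
  apply: contra_neq z1 => zz; rewrite -z5.
  by rewrite -[5%N]/(2 + 2 + 1)%N !exprD zz !mul1r.
set J := qpoch 1 A * qpoch (z ^+ 2) A * qpoch ((z ^+ 2) ^+ 4) A.
have J0 : J`_N = 0 by apply: theta_coef.
have : eqX A ((qpoch 1 A \Po 'X^5) * p) J.
  rewrite -qpoch_fifth_roots -/J -mulrA -[X in eqX _ _ X]mulr1.
  exact: eqX_mul (eqX_refl _ _) pE.
move/eqX_coef => /(_ N ltNA); rewrite J0 coefM big_ord_recl /= subn0.
rewrite coef_comp_poly_Xn // dvdn0 div0n qpoch_coef0 mul1r big1 ?addr0 // => i _.
rewrite /bump add1n coef_comp_poly_Xn //; case: ifP => d5; last by rewrite mul0r.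
have ltiN := ltn_ord i.
by rewrite IH ?mulr0 //; try lia; move: N5; rewrite -{1}(subnK ltiN) -modnDmr (eqP d5) addn0.
Qed.

End FifthRoot.

(** * Generating polynomials of bit words *)

Fixpoint allbits (K : nat) : seq bitseq :=
  if K is K'.+1 then
    [seq true :: w | w <- allbits K'] ++ [seq false :: w | w <- allbits K']
  else [:: [::]].

(** The sum of the positions of the true bits: prepending a bit moves every later one up by one. *)
Fixpoint wsum (w : bitseq) : nat :=
  if w is b :: w' then (wsum w' + count id w')%N else 0%N.

(* For the bits of X_c this is nu(hat pi_c). *)
Fixpoint gaps (w : bitseq) : nat :=
  if w is b :: w' then ((~~ b && has id w') + gaps w')%N else 0%N.

Section BitPoly.
Variables (R : comNzRingType) (z : R).

Definition bitpoly K a : {poly R} :=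
  \sum_(w <- allbits K | count id w == a) (z ^+ gaps w)%:P * 'X^(wsum w).

(* Truncation of 1 / ((1 - zX) ... (1 - zX^a)); the recursion deletes the first bit. *)
Fixpoint hpoly (K a : nat) : {poly R} :=
  match K, a with
  | _, 0 => 1
  | 0, _.+1 => 0
  | K'.+1, a'.+1 => hpoly K' a' + z%:P * 'X^(a'.+1) * hpoly K' a'.+1
  end.

(** C(a, 2) is the least weight, with all true bits in front. Deleting a leading false bit before a
    > 0 true ones removes a gap and lowers the weight by a, whence the factor z X^a. *)
Lemma bitpolyE K a : bitpoly K a = 'X^('C(a, 2)) * hpoly K a.
Proof.
rewrite /bitpoly; elim: K a => [|K IH] a.
  rewrite /= big_cons big_nil; case: a => [|a] /=.
    by rewrite !expr0 polyC1 !mulr1 addr0.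
  by rewrite mulr0.
rewrite [allbits _]/= big_cat !big_map /=.
case: a => [|a].
  rewrite big1_seq => [|w] //.
  rewrite add0r mulr1; transitivity ('X^('C(0, 2)) * hpoly K 0);
    last by case: (K) => *; rewrite mulr1.
  rewrite -IH; apply: eq_bigr => w; rewrite add0n => /eqP w0.
  by rewrite has_count w0 addn0.
have -> : \sum_(w <- allbits K | (1 + count id w == a.+1)%N)
     (z ^+ (0 + gaps w))%:P * 'X^(wsum w + count id w)
   = 'X^a * ('X^('C(a, 2)) * hpoly K a).
  rewrite -IH big_distrr /=; apply: eq_big => [w|w /eqP[<-]]; first by rewrite add1n eqSS.
  by rewrite add0n exprD; ring.
have -> : \sum_(w <- allbits K | (0 + count id w == a.+1)%N)
     (z ^+ (has id w + gaps w))%:P * 'X^(wsum w + count id w)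
   = z%:P * 'X^(a.+1) * ('X^('C(a.+1, 2)) * hpoly K a.+1).
  rewrite -IH big_distrr /=; apply: eq_big => [w|w]; first by rewrite add0n.
  by rewrite add0n has_count => /eqP ->; rewrite !exprD expr1 polyCM; ring.
by rewrite /= binS bin1 exprD; ring.
Qed.

(** By the recursion the product becomes (1 - z X^(a+1)) + z X^(a+1) = 1 up to the stated order. *)
Lemma hpoly_qpoch K a : eqX (K.+1 - a) (qpoch z a * hpoly K a) 1.
Proof.
have h0 L : qpoch z 0 * hpoly L 0 = 1 by rewrite /qpoch big_ord0 mul1r; case: L.
elim: K a => [|K IH] [|a].
- by rewrite h0; apply: eqX_refl.
(* The order is 0 here, so the congruence is void. *)
- by exists (-1); rewrite /= subSS sub0n expr0; ring.
- by rewrite h0; apply: eqX_refl.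
rewrite [hpoly _ _]/= mulrDr.
have -> : qpoch z a.+1 * hpoly K a = (1 - z%:P * 'X^(a.+1)) * (qpoch z a * hpoly K a).
  by rewrite qpochS; ring.
have -> : qpoch z a.+1 * (z%:P * 'X^(a.+1) * hpoly K a.+1) =
   z%:P * ('X^(a.+1) * (qpoch z a.+1 * hpoly K a.+1)) by ring.
apply: (@eqX_trans _ _ _ ((1 - z%:P * 'X^(a.+1)) * 1 + z%:P * ('X^(a.+1) * 1))).
  apply: eqX_add; apply: eqX_mul (eqX_refl _ _) _; first by rewrite subSS; apply: IH.
  by apply: eqX_le (eqX_mulXn _ (IH _)); lia.
have -> : (1 - z%:P * 'X^(a.+1)) * 1 + z%:P * ('X^(a.+1) * 1) = 1 by ring.
exact: eqX_refl.
Qed.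

End BitPoly.

Lemma bitpoly_mulE (R : comNzRingType) (z y : R) K a b :
  bitpoly z K a * bitpoly y K b =
  'X^('C(a, 2) + 'C(b, 2)) * (hpoly z K a * hpoly y K b).
Proof. by rewrite !bitpolyE exprD; ring. Qed.

(** The bounds N <= a, b make the products of length a and b agree with the infinite ones up to X^N;
    those on K do the same for the word length. *)
Lemma bitpoly_coef (F : fieldType) (z : F) (K a b N : nat) :
  z ^+ 5 = 1 -> z != 1 -> (2%:R : F) != 0 ->
  (N <= a)%N -> (N <= b)%N -> (a + N <= K)%N -> (b + N <= K)%N ->
  (N %% 5 \in [:: 2; 3; 4])%N ->
  (bitpoly z K a * bitpoly (z ^+ 4) K b)`_('C(a, 2) + 'C(b, 2) + N) = 0.
Proof.
move=> z5 z1 F2 Na Nb aK bK N5; rewrite bitpoly_mulE.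
rewrite coefXnM ltnNge leq_addr /= addKn.
apply: (@birank_coef _ _ z5 z1 F2 N.+1 N) => //.
have h y c : (N <= c)%N -> (c + N <= K)%N -> eqX N.+1 (qpoch y N.+1 * hpoly y K c) 1.
  move=> le1 le2.
  apply: (@eqX_trans _ _ _ (qpoch y c * hpoly y K c)); last first.
    by apply: eqX_le (hpoly_qpoch _ _ _); lia.
  apply: eqX_mul (eqX_refl _ _).
  apply: eqX_trans (qpoch_stable y (leqnSn _)) (eqX_sym _).
  exact: qpoch_stable.
have -> : qpoch z N.+1 * qpoch (z ^+ 4) N.+1 * (hpoly z K a * hpoly (z ^+ 4) K b)
  = (qpoch z N.+1 * hpoly z K a) * (qpoch (z ^+ 4) N.+1 * hpoly (z ^+ 4) K b) by ring.
rewrite -[1]mulr1; apply: eqX_mul; exact: h.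
Qed.

(** * Beta-sets and their parity halves *)

Section BetaSets.
Local Open Scope nat_scope.

Lemma mem_allbits K w : (w \in allbits K) = (size w == K).
Proof.
elim: K w => [|K IH] w; first by rewrite inE; case: w.
rewrite mem_cat; case: w => [|b w] /=.
  by apply/norP; split; apply/mapP => -[].
have inj c : injective (cons c : bitseq -> bitseq) by move=> x y [].
rewrite eqSS -IH; case: b.
  rewrite (mem_map (inj true)) orbC; case: mapP => // -[? _ []] //.
by rewrite (mem_map (inj false)); case: mapP => // -[? _ []].
Qed.

Lemma uniq_allbits K : uniq (allbits K).
Proof.
elim: K => //= K IH.
rewrite cat_uniq !map_inj_uniq ?IH => [|x y []|x y []] //=; rewrite andbT.
by apply/hasPn => w /mapP[w' _ ->]; apply/mapP => -[].
Qed.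

Lemma count_bits w : count id w = \sum_(i < size w) nth false w i.
Proof. by elim: w => [|b w IH] /=; rewrite ?big_ord0 // big_ord_recl IH. Qed.

Lemma wsum_bits w : wsum w = \sum_(i < size w) i * nth false w i.
Proof.
elim: w => [|b w IH] /=; first by rewrite big_ord0.
rewrite big_ord_recl mul0n add0n IH count_bits -big_split /=.
by apply: eq_bigr => i _; rewrite /bump add1n mulSn addnC.
Qed.

Lemma gaps_bits w : gaps w =
  count (fun i => ~~ nth false w i && has id (drop i.+1 w)) (iota 0 (size w)).
Proof.
elim: w => [|b w IH] //=; rewrite drop0 IH; congr (_ + _).
by rewrite -[1]/(1 + 0) iotaDl count_map.
Qed.

Lemma big_half (R : Type) (idx : R) (op : Monoid.law idx) (G : nat -> R) K :
  \big[op/idx]_(i < K.*2) G i = \big[op/idx]_(i < K) op (G i.*2) (G i.*2.+1).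
Proof.
elim: K => [|K IH]; first by rewrite !big_ord0.
by rewrite doubleS !big_ord_recr /= IH Monoid.mulmA.
Qed.

Lemma big_uniq_nat (xs : seq nat) N (G : nat -> nat) :
  uniq xs -> (forall x, x \in xs -> x < N) ->
  \sum_(x <- xs) G x = \sum_(x < N) ((x : nat) \in xs) * G x.
Proof.
move=> u lt; transitivity (\sum_(0 <= x < N) (x \in xs) * G x); last by rewrite big_mkord.
rewrite (perm_big [seq x <- index_iota 0 N | x \in xs]) /=; last first.
  apply: uniq_perm => //; first by rewrite filter_uniq ?iota_uniq.
  by move=> x; rewrite mem_filter mem_index_iota; case: (boolP (x \in xs)) => // /lt.
rewrite big_filter [RHS](bigID (mem xs)) /= [X in _ = _ + X]big1 ?addn0; last first.
  by move=> i /negPf ->.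
by apply: eq_bigr => i ->; rewrite mul1n.
Qed.

(** For a beta-set this is the indicator word of S_c shifted by M. *)
Definition halfbits (K c : nat) (xs : seq nat) : bitseq :=
  mkseq (fun y => c + y.*2 \in xs) K.

Section HalfBits.
Variables (xs : seq nat) (K : nat).
Hypotheses (uxs : uniq xs) (ltxs : forall x, x \in xs -> x < K.*2).

Lemma sum_halfbits (G : nat -> nat) :
  \sum_(x <- xs) G x = \sum_(i < K) nth false (halfbits K 0 xs) i * G i.*2 +
     \sum_(i < K) nth false (halfbits K 1 xs) i * G i.*2.+1.
Proof.
rewrite (big_uniq_nat G uxs ltxs) (big_half _ (fun x => (x \in xs) * G x)) big_split /=.
by congr (_ + _); apply: eq_bigr => i _; rewrite nth_mkseq.
Qed.

Lemma count_halfbits0 : count id (halfbits K 0 xs) = count (predC odd) xs.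
Proof.
rewrite -[RHS]sum1_count big_mkcond /= sum_halfbits [X in _ + X]big1 ?addn0; last first.
  by move=> i _; rewrite /= odd_double muln0.
by rewrite count_bits size_mkseq; apply: eq_bigr => i _; rewrite odd_double muln1.
Qed.

Lemma count_halfbits1 : count id (halfbits K 1 xs) = count odd xs.
Proof.
rewrite -[RHS]sum1_count big_mkcond /= sum_halfbits [X in X + _]big1 ?add0n; last first.
  by move=> i _; rewrite odd_double muln0.
by rewrite count_bits size_mkseq; apply: eq_bigr => i _; rewrite /= odd_double muln1.
Qed.

Lemma sumn_halfbits : sumn xs =
  (wsum (halfbits K 0 xs)).*2 + (wsum (halfbits K 1 xs)).*2 + count id (halfbits K 1 xs).
Proof.
rewrite sumnE (sum_halfbits id) -addnA; congr (_ + _).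
  rewrite wsum_bits size_mkseq -muln2 big_distrl; apply: eq_bigr => i _ /=.
  by rewrite -muln2 -mulnA mulnCA mulnA.
rewrite wsum_bits count_bits size_mkseq -muln2 big_distrl -big_split.
by apply: eq_bigr => i _ /=; rewrite -muln2; lia.
Qed.

End HalfBits.

(** Two words interleave into one set, from which both are recovered; this serves surjectivity. *)
Lemma bits_halfbits K (u v : bitseq) (xs : seq nat) :
  size u = K -> size v = K ->
  (forall x, (x \in xs) = nth false (if odd x then v else u) x./2) ->
  [/\ halfbits K 0 xs = u, halfbits K 1 xs = v & forall x, x \in xs -> x < K.*2].
Proof.
move=> su sv mx; split.
- apply: (@eq_from_nth _ false); rewrite size_mkseq ?su // => i ltiK.
  by rewrite nth_mkseq // mx add0n odd_double doubleK.
- apply: (@eq_from_nth _ false); rewrite size_mkseq ?sv // => i ltiK.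
  by rewrite nth_mkseq // mx add1n /= odd_double /= uphalf_double.
move=> x; rewrite mx => nx; rewrite ltnNge; apply/negP => le.
by move: nx; rewrite nth_default //; case: ifP => _; rewrite ?su ?sv; lia.
Qed.

(* The beta-set in decreasing order: with j counted from 1, the numbers
   lambda_j - j + 2M.  The even shift 2M keeps the parity classes S_0 and S_1. *)
Definition beta (M : nat) (p : seq nat) : seq nat :=
  mkseq (fun j => nth 0 p j + (M.*2.-1 - j)) M.*2.

Section Beta.
Variables (M : nat) (p : seq nat).
Hypotheses (sp : sorted geq p) (szp : size p <= M.*2).

Lemma nth_geq i j : i <= j -> nth 0 p j <= nth 0 p i.
Proof.
move=> le; have [ltj|] := ltnP j (size p); last by move=> ?; rewrite [nth _ p j]nth_default.
move: sp => /(sorted_leq_nth (rev_trans leq_trans) leqnn 0); apply => //.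
by rewrite inE; apply: leq_ltn_trans ltj.
Qed.

Lemma beta_sorted : sorted gtn (beta M p).
Proof.
clear szp.
apply/(sortedP 0) => i; rewrite size_mkseq => lti.
rewrite !nth_mkseq //; try lia.
by have := nth_geq (leqnSn i) => /=; lia.
Qed.

Lemma beta_uniq : uniq (beta M p).
Proof. exact: (sorted_uniq (rev_trans ltn_trans) ltnn beta_sorted). Qed.

Lemma beta_bound N : (forall j, nth 0 p j <= N) -> forall x, x \in beta M p -> x < N + M.*2.
Proof.
clear sp szp.
move=> le x /(nthP 0)[i]; rewrite size_mkseq => lti <-.
by rewrite nth_mkseq //; have := le i; lia.
Qed.

Lemma sumn_beta : sumn (beta M p) = sumn p + 'C(M.*2, 2).
Proof.
clear sp.
have iotaE : iota 0 M.*2 = index_iota 0 M.*2 by rewrite /index_iota subn0.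
rewrite sumnE big_map iotaE big_mkord big_split /=; congr (_ + _).
  rewrite sumnE (big_nth 0) big_mkord (big_ord_widen _ (fun i => nth 0 p i) szp).
  rewrite [RHS]big_mkcond /=; apply: eq_bigr => i _.
  by case: ltnP => // ?; rewrite nth_default.
rewrite -bin2_sum big_mkord [RHS](reindex_inj rev_ord_inj) /=.
by apply: eq_bigr => i _; have := ltn_ord i; lia.
Qed.

End Beta.

Lemma beta_inj M p q : beta M p = beta M q -> size p = size q -> size p <= M.*2 -> p = q.
Proof.
move=> e s le; apply: (@eq_from_nth _ 0) => // i lti.
have := congr1 (nth 0 ^~ i) e; rewrite !nth_mkseq; lia.
Qed.

Lemma gtn_sorted_eq (xs ys : seq nat) :
  sorted gtn xs -> sorted gtn ys -> xs =i ys -> xs = ys.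
Proof. exact: (irr_sorted_eq (rev_trans ltn_trans) ltnn). Qed.

(** Subtracting the staircase turns a strictly decreasing list into a nonincreasing one; its sum n
    leaves at most n nonzero entries, so it can be cut to length n. *)
Lemma beta_surj M n (xs : seq nat) :
  n <= M.*2 -> size xs = M.*2 -> sorted gtn xs -> sumn xs = n + 'C(M.*2, 2) ->
  exists p, [/\ size p = n, sorted geq p, sumn p = n & beta M p = xs].
Proof.
move=> len sx sor sm; set L := M.*2 in len sx sm *.
have gt i : i.+1 < L -> nth 0 xs i.+1 < nth 0 xs i.
  by move=> lt; move/(sortedP 0): sor => /(_ i); rewrite sx; apply.
(* Strict decrease puts every entry above the staircase, so the truncated subtraction in [lam] is
   exact. *)
have lb d : forall i, i + d = L.-1 -> i < L -> d <= nth 0 xs i.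
  elim: d => // d IH i e lt.
  by apply: leq_ltn_trans (gt i _); [apply: IH; lia | lia].
pose lam i := nth 0 xs i - (L.-1 - i).
pose q := mkseq lam L.
have sq : sorted geq q.
  apply/(sortedP 0) => i; rewrite size_mkseq => lt; rewrite !nth_mkseq //; try lia.
  have := gt i lt; rewrite /lam /=; lia.
have bq : beta M q = xs.
  apply: (@eq_from_nth _ 0); rewrite size_mkseq ?sx // => i lti.
  rewrite !nth_mkseq // /lam subnK //; apply: lb => //; lia.
have sumq : sumn q = n.
  by apply/eqP; rewrite -(eqn_add2r 'C(L, 2)) -sm -bq sumn_beta // size_mkseq.
have q0 i : n <= i -> nth 0 q i = 0.
  move=> le; apply/eqP; rewrite -leqn0 leqNgt; apply/negP => pos.
  have lti : i < L.
    by rewrite ltnNge; apply/negP => ?; move: pos; rewrite nth_default // size_mkseq.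
  (* A positive entry at index i >= n would give i + 1 > n positive entries, too many for the sum
     n. *)
  suff : i.+1 <= sumn q by rewrite sumq; lia.
  rewrite -(cat_take_drop i.+1 q) sumn_cat; apply: leq_trans (leq_addr _ _).
  rewrite sumnE (big_nth 0) size_take size_mkseq.
  have -> : (if i.+1 < L then i.+1 else L) = i.+1 by case: ifP; lia.
  rewrite -{1}[i.+1]subn0 -[_ - 0]muln1 -sum_nat_const_nat big_nat [X in _ <= X]big_nat.
  apply: leq_sum => j /andP[_ ltj]; rewrite nth_take //.
  by apply: leq_trans pos (nth_geq sq _).
have tn j : nth 0 (take n q) j = nth 0 q j.
  have [lt|le] := ltnP j n; first by rewrite nth_take.
  by rewrite q0 // nth_default // size_take size_mkseq; case: ifP; lia.
exists (take n q); split.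
- by rewrite size_take size_mkseq; case: ifP; lia.
- exact: take_sorted.
- have := sumq; rewrite -{1}(cat_take_drop n q) sumn_cat.
  suff -> : sumn (drop n q) = 0 by rewrite addn0.
  rewrite sumnE (big_nth 0) big_nat big1 // => i _.
  by rewrite nth_drop q0 // leq_addr.
- by rewrite -bq; apply: eq_map => j; rewrite tn.
Qed.

End BetaSets.

(** * Coding of partitions by zero-padded lists *)

Lemma size_fvals n (f : {ffun 'I_n -> 'I_n.+1}) : size (fvals f) = n.
Proof. by rewrite size_map size_enum_ord. Qed.

Lemma nth_fvals n (f : {ffun 'I_n -> 'I_n.+1}) (i : 'I_n) : nth 0%N (fvals f) i = f i.
Proof. by rewrite (nth_map i) ?nth_ord_enum // size_enum_ord. Qed.

Lemma fvals_inj n : injective (@fvals n).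
Proof.
move=> f g e; apply/ffunP => i; apply: val_inj.
by rewrite /= -!nth_fvals e.
Qed.

Lemma fvals_surj n (p : seq nat) : size p = n -> sumn p = n ->
  exists f : {ffun 'I_n -> 'I_n.+1}, fvals f = p.
Proof.
move=> sz sm; exists [ffun i : 'I_n => inord (nth 0%N p i)].
apply: (@eq_from_nth _ 0%N); rewrite size_fvals // => i lti.
rewrite -[i]/(nat_of_ord (Ordinal lti)) nth_fvals ffunE /= inordK // ltnS -[X in (_ <= X)%N]sm.
rewrite sumnE (big_rem (nth 0%N p i)) ?mem_nth ?sz //=.
exact: leq_addr.
Qed.

(** The zeros of a nonincreasing list are trailing, and the default value of [nth] restores them. *)
Lemma nth_pos_part (p : seq nat) i : sorted geq p ->
  nth 0%N [seq x <- p | (0 < x)%N] i = nth 0%N p i.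
Proof.
elim: p i => [|[|x] p IH] i sp; first by rewrite !nth_nil.
  have h := @nth_geq _ sp 0 i isT; rewrite /= leqn0 in h; rewrite (eqP h) /=.
  rewrite (@eq_in_filter _ _ pred0) ?filter_pred0 ?nth_nil // => y yp.
  have := order_path_min (rev_trans leq_trans) sp => /allP /(_ y yp).
  by case: y {yp}.
case: i => //= i; apply: IH; exact: path_sorted sp.
Qed.

(** * BG-rank and 2-quotient read off the beta-set *)

Section Frobenius.
Variables (p : seq nat) (M K : nat).
Hypotheses (sp : sorted geq p) (szp : (size p <= M.*2)%N).
Hypothesis bound : forall x, x \in beta M p -> (x < K.*2)%N.
Let P := [seq x <- p | (0 < x)%N].

Lemma lam_parts j : lam P j = nth 0%N p j.-1.
Proof. exact: nth_pos_part. Qed.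

(** The indices j <= 2M give the beta-set; beyond them lambda_j = 0, which gives every x < -2M. *)
Lemma inS_beta (x : int) :
  inS P x <-> x + M.*2%:Z < 0 \/ exists2 y : nat, x + M.*2%:Z = y%:Z & y \in beta M p.
Proof.
split.
  case=> -[|j] [] // _ ->; rewrite lam_parts /=.
  have [lt|le] := ltnP j M.*2; [right | left].
    exists (nth 0 p j + (M.*2.-1 - j))%N; first lia.
    by apply/mapP; exists j => //; rewrite mem_iota.
  rewrite nth_default; lia.
case=> [neg|[y e /mapP[j]]].
  exists `|x|%N; split; first lia.
  rewrite lam_parts nth_default; lia.
rewrite mem_iota => /andP[_ lt] yE; exists j.+1; split=> //.
rewrite lam_parts /=; lia.
Qed.

Lemma inSc_beta (c : nat) (k : int) : (c < 2)%N ->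
  inSc P c%:Z k <->
  k + M%:Z < 0 \/ exists2 y : nat, k + M%:Z = y%:Z & nth false (halfbits K c (beta M p)) y.
Proof.
move=> c2; rewrite /inSc; split.
  case/inS_beta => [neg|[y e yb]]; [by left; lia | right].
  have [z zE] : exists z : nat, k + M%:Z = z%:Z by exists (absz (k + M%:Z)%R); lia.
  have yE : y = (c + z.*2)%N by lia.
  by exists z => //; rewrite nth_mkseq -?yE //; have := bound yb; lia.
move=> h; apply/inS_beta; case: h => [neg|[y e]]; first by left; lia.
have [lt|le] := ltnP y K; last by rewrite nth_default ?size_mkseq.
by rewrite nth_mkseq // => yb; right; exists (c + y.*2)%N => //; lia.
Qed.

(** All integers below -M lie in S_c, so each gap sits at a position of the word: a false bit with a
    true bit after it. *)
Lemma nu_hat_is_gaps (c : nat) : (c < 2)%N ->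
  nu_hat_is P c%:Z (gaps (halfbits K c (beta M p))).
Proof.
move=> c2; set w := halfbits _ _ _.
have Sc k := @inSc_beta c k c2; rewrite -/w in Sc.
pose g0 (i : nat) := ~~ nth false w i && has id (drop i.+1 w).
exists [seq i%:Z - M%:Z | i <- iota 0 (size w) & g0 i]; split.
- rewrite map_inj_uniq ?filter_uniq ?iota_uniq // => i j; lia.
- move=> g; split.
    case/mapP => i; rewrite mem_filter => /andP[/andP[/negP ni hi] _] ->.
    split.
      move/Sc => [|[y e]]; first lia.
      by have -> : y = i by lia.
    case/(has_nthP false): hi => t; rewrite size_drop => ltt; rewrite nth_drop => wt.
    exists ((i.+1 + t)%N%:Z - M%:Z); split; last lia.
    by apply/Sc; right; exists (i.+1 + t)%N => //; lia.
  case=> ng [t [/Sc tS lt]].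
  have g0' : 0 <= g + M%:Z by rewrite leNgt; apply/negP => neg; apply: ng; apply/Sc; left.
  case: tS => [|[y yE wy]]; first lia.
  have lty : (y < size w)%N by rewrite ltnNge; apply/negP => le; rewrite nth_default in wy.
  have [i iE] : exists i : nat, g + M%:Z = i%:Z by exists (absz (g + M%:Z)%R); lia.
  apply/mapP; exists i; last lia.
  rewrite mem_filter mem_iota; apply/andP; split; last lia.
  apply/andP; split; first by apply/negP => wi; apply: ng; apply/Sc; right; exists i.
  apply/(has_nthP false); exists (y - i.+1)%N; first by rewrite size_drop; lia.
  by rewrite nth_drop subnKC //; lia.
- by rewrite size_map size_filter gaps_bits.
Qed.

(** Consecutive entries are taken in pairs. The first is shifted by an odd number and the second by
    an even one, so a pair has 1 + par(lambda) - par(lambda') even entries. *)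
Lemma count_even_beta :
  (count (predC odd) (beta M p))%:Z = M%:Z + BG_rank P.
Proof.
have -> : BG_rank P = \sum_(j < M.*2) (-1) ^+ j * par (nth 0%N p j).
  have le : (size P <= M.*2)%N by apply: leq_trans szp; rewrite size_filter count_size.
  rewrite /BG_rank big_add1 big_mkord.
  rewrite (big_ord_widen _ (fun j => (-1) ^+ j.+2 * par (lam P j.+1)) le) big_mkcond /=.
  apply: eq_bigr => j _; rewrite lam_parts /= !exprS mulN1r mulN1r opprK.
  case: ltnP => // le'; rewrite -nth_pos_part // nth_default //.
  by rewrite mulr0.
have iotaE : iota 0 M.*2 = index_iota 0 M.*2 by rewrite /index_iota subn0.
rewrite -sum1_count big_mkcond /= big_map iotaE big_mkord.
rewrite (big_half _ (fun j => (-1) ^+ j * par (nth 0%N p j))).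
rewrite (big_half _ (fun j => if ~~ odd (nth 0 p j + (M.*2.-1 - j)) then 1 else 0)%N).
have MZ : M%:Z = \sum_(i < M) 1 by rewrite sumr_const card_ord natz.
rewrite (big_morph _ PoszD (erefl _)) MZ -big_split /=.
apply: eq_bigr => i _; have := ltn_ord i => lti.
have -> : (M.*2.-1 - i.*2 = (M.-1 - i).*2.+1)%N by lia.
have -> : (M.*2.-1 - i.*2.+1 = (M.-1 - i).*2)%N by lia.
rewrite addnS /= !oddD !odd_double !addbF /par negbK.
rewrite exprS -signr_odd odd_double expr0.
by case: (odd _); case: (odd _).
Qed.

End Frobenius.

Lemma nu_hat_is_inj p c N N' : nu_hat_is p c N -> nu_hat_is p c N' -> N = N'.
Proof.
move=> [s [us ms <-]] [t [ut mt <-]]; apply: perm_size; apply: uniq_perm => // g.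
by apply/idP/idP => [/ms /mt|/mt /ms].
Qed.

(** * The bijection between partitions and pairs of words *)

Definition part_codes (j : int) (n : nat) : {set {ffun 'I_n -> 'I_n.+1}} :=
  [set f | is_part_code f && (BG_rank (parts_of f) == j)].

Definition quot_bits (M K : nat) (p : seq nat) : bitseq * bitseq :=
  (halfbits K 0 (beta M p), halfbits K 1 (beta M p)).

(** The last equation is the sum of the beta-set: even members are 2y, odd ones 2y + 1, and b of
    them are odd. *)
Definition bit_pairs (K a b n M : nat) : seq (bitseq * bitseq) :=
  [seq x <- [seq (u, v) | u <- allbits K, v <- allbits K] |
    [&& count id x.1 == a, count id x.2 == b &
        (wsum x.1 + wsum x.2).*2 + b == n + 'C(M.*2, 2)]%N].

Section QuotBits.
Variables (j : int) (n M K a b : nat).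
Hypotheses (nM : (n <= M.*2)%N) (MK : (n + M.*2 <= K.*2)%N).
Hypotheses (aE : a%:Z = M%:Z + j) (bE : b%:Z = M%:Z - j).

Lemma part_code_bound (f : {ffun 'I_n -> 'I_n.+1}) x :
  sorted geq (fvals f) -> x \in beta M (fvals f) -> (x < K.*2)%N.
Proof.
move=> sf xb; apply: leq_trans MK; apply: beta_bound xb => i.
have [lt|le] := ltnP i n; last by rewrite nth_default // size_fvals.
by rewrite -[i]/(nat_of_ord (Ordinal lt)) nth_fvals -ltnS.
Qed.

Lemma count_odd_beta p : sorted geq p -> (size p <= M.*2)%N ->
  (count odd (beta M p))%:Z = M%:Z - BG_rank [seq x <- p | (0 < x)%N].
Proof.
move=> sp szp; have := count_even_beta sp szp.
have := count_predC odd (beta M p); rewrite size_mkseq; lia.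
Qed.

Lemma quot_bits_inj :
  {in part_codes j n &, injective (fun f => quot_bits M K (fvals f))}.
Proof.
move=> f g; rewrite !inE => /andP[/andP[sf _] _] /andP[/andP[sg _] _] [e0 e1].
apply: fvals_inj; apply: (@beta_inj M); rewrite ?size_fvals //.
apply: gtn_sorted_eq; try exact: beta_sorted.
have mem_nth (h : {ffun 'I_n -> 'I_n.+1}) x : (x < K.*2)%N -> (x \in beta M (fvals h)) =
    nth false (halfbits K (odd x) (beta M (fvals h))) x./2.
  by move=> lt; rewrite nth_mkseq ?odd_double_half //; lia.
move=> x; have [lt|le] := ltnP x K.*2.
  by rewrite !mem_nth //; case: (odd x); rewrite ?e0 ?e1.
have nb (h : {ffun 'I_n -> 'I_n.+1}) : sorted geq (fvals h) -> (x \in beta M (fvals h)) = false.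
  by move=> sh; apply/negP => /(part_code_bound sh); rewrite ltnNge le.
by rewrite !nb.
Qed.

Lemma mem_quot_bits (uv : bitseq * bitseq) :
  reflect (exists2 f, f \in part_codes j n & uv = quot_bits M K (fvals f))
          (uv \in bit_pairs K a b n M).
Proof.
have ltb f := @part_code_bound f.
apply: (iffP idP) => [|[f]].
  rewrite mem_filter => /andP[/and3P[/eqP cu /eqP cv /eqP sm] /allpairsP[[u v] /= [uK vK e]]].
  rewrite {uv}e /= in cu cv sm *.
  rewrite mem_allbits in uK; rewrite mem_allbits in vK.
  pose Px x := nth false (if odd x then v else u) x./2.
  (* The two words are interleaved into a decreasing list, the beta-set of the partition sought. *)
  pose xs := rev [seq x <- iota 0 K.*2 | Px x].
  have mx x : (x \in xs) = Px x.
    rewrite mem_rev mem_filter mem_iota /= add0n.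
    case: (boolP (Px x)) => // Pxx; rewrite ltnNge; apply/negP => le.
    by move: Pxx; rewrite /Px nth_default //; case: ifP => _; rewrite ?(eqP uK) ?(eqP vK); lia.
  have [e0 e1 ltx] := bits_halfbits (eqP uK) (eqP vK) mx.
  have sx : sorted gtn xs
    by rewrite rev_sorted; apply: sorted_filter (iota_ltn_sorted _ _); apply: ltn_trans.
  have ux : uniq xs by rewrite rev_uniq filter_uniq ?iota_uniq.
  have szx : size xs = M.*2.
    rewrite -(count_predC odd) -(count_halfbits0 ux ltx) -(count_halfbits1 ux ltx) e0 e1 cu cv; lia.
  have smx : sumn xs = (n + 'C(M.*2, 2))%N.
    by rewrite (sumn_halfbits ux ltx) e0 e1 cv -sm doubleD.
  have [p [szp sp smp bp]] := beta_surj nM szx sx smx.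
  have [f fE] := fvals_surj szp smp.
  exists f; last by rewrite fE /quot_bits bp e0 e1.
  rewrite inE /is_part_code fE sp smp eqxx /=.
  have szp' : (size p <= M.*2)%N by rewrite szp.
  have := count_even_beta sp szp'; rewrite bp -(count_halfbits0 ux ltx) e0 cu aE.
  by rewrite /parts_of fE => /addrI ->.
rewrite inE => /andP[/andP[sf /eqP sm] /eqP bg] ->.
have szf : (size (fvals f) <= M.*2)%N by rewrite size_fvals.
have ub := beta_uniq M sf; have lt x := @ltb f x sf.
rewrite mem_filter /= count_halfbits0 // count_halfbits1 //; apply/andP; split.
  have h0 : count (predC odd) (beta M (fvals f)) = a.
    by have := count_even_beta sf szf; rewrite -/(parts_of f) bg -aE => -[].
  have h1 : count odd (beta M (fvals f)) = b.
    by have := count_odd_beta sf szf; rewrite -/(parts_of f) bg -bE => -[].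
  rewrite h0 h1 !eqxx /= -[X in (_ == X + _)%N]sm -sumn_beta // (sumn_halfbits ub lt).
  by rewrite count_halfbits1 // h1 doubleD.
by apply: allpairs_f; rewrite mem_allbits size_mkseq.
Qed.

Lemma sum_part_codes (R : nmodType) (g : bitseq * bitseq -> R) :
  \sum_(f in part_codes j n) g (quot_bits M K (fvals f)) =
  \sum_(x <- bit_pairs K a b n M) g x.
Proof.
rewrite -big_enum -(big_map (fun f => quot_bits M K (fvals f)) xpredT g) /=.
apply: perm_big; apply: uniq_perm.
- rewrite map_inj_in_uniq ?enum_uniq // => f g'; rewrite !mem_enum; exact: quot_bits_inj.
- apply: filter_uniq; apply: allpairs_uniq; rewrite ?uniq_allbits //.
  by move=> [? ?] [? ?].
move=> x; apply/mapP/mem_quot_bits => -[f fS ->]; exists f => //.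
  by rewrite mem_enum in fS.
by rewrite mem_enum.
Qed.

End QuotBits.

(** * Root-of-unity sums over partitions, and equidistribution *)

Lemma bitpoly_coefM (R : comNzRingType) (z y : R) K a b T :
  (bitpoly z K a * bitpoly y K b)`_T =
  \sum_(x <- [seq (u, v) | u <- allbits K, v <- allbits K] |
     [&& count id x.1 == a, count id x.2 == b & wsum x.1 + wsum x.2 == T]%N)
   z ^+ gaps x.1 * y ^+ gaps x.2.
Proof.
rewrite /bitpoly big_distrl coef_sum [RHS]big_mkcond big_allpairs_dep /= [LHS]big_mkcond.
apply: eq_bigr => u _; case: ifP => cu; last by rewrite big1.
rewrite big_distrr coef_sum /= big_mkcond; apply: eq_bigr => v _.
case: ifP => //= cv.
have -> : (z ^+ gaps u)%:P * 'X^(wsum u) * ((y ^+ gaps v)%:P * 'X^(wsum v))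
   = (z ^+ gaps u * y ^+ gaps v)%:P * 'X^(wsum u + wsum v).
  by rewrite exprD polyCM; ring.
by rewrite coefCM coefXn eq_sym; case: eqP => _; rewrite ?mulr1 ?mulr0.
Qed.

(** With M = n + |j| and K = 2M, both M + j and M - j lie between n and K - n, as [bitpoly_coef]
    requires for every N <= n. *)
Definition rank_shift (j : int) (n : nat) := (n + `|j|)%N.
Definition rank_width (j : int) (n : nat) := (n + `|j|).*2.

(* 4 stands for -1: only the residue mod 5 of the 2-quotient-rank matters. *)
Definition rank5 (j : int) (n : nat) (f : {ffun 'I_n -> 'I_n.+1}) : nat :=
  let x := quot_bits (rank_shift j n) (rank_width j n) (fvals f) in
  (gaps x.1 + 4 * gaps x.2)%N.

Lemma bin2Z (m : nat) : 2 * ('C(m, 2))%:Z = m%:Z * m%:Z - m%:Z.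
Proof. by elim: m => [|m IH] //; rewrite binS bin1; nia. Qed.

(** The condition ranges over all N because a suitable N may fail to exist; the sum is then 0 for
    parity or size reasons. *)
Lemma twisted_sum (F : fieldType) (z : F) (j : int) (n : nat) :
  z ^+ 5 = 1 -> z != 1 -> (2%:R : F) != 0 ->
  (forall N : nat, n%:Z = 2 * N%:Z + 2 * j * j - j -> (N %% 5)%N \in [:: 2; 3; 4]%N) ->
  \sum_(f in part_codes j n) z ^+ rank5 j f = 0.
Proof.
move=> z5 z1 F2 hN; set M := rank_shift j n; set K := rank_width j n.
have [a aE] : exists a : nat, a%:Z = M%:Z + j
  by exists (absz (M%:Z + j)%R); rewrite /M /rank_shift; lia.
have [b bE] : exists b : nat, b%:Z = M%:Z - j
  by exists (absz (M%:Z - j)%R); rewrite /M /rank_shift; lia.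
have nM : (n <= M.*2)%N by rewrite /M /rank_shift; lia.
have MK : (n + M.*2 <= K.*2)%N by rewrite /M /K /rank_shift /rank_width; lia.
pose g (x : bitseq * bitseq) := z ^+ gaps x.1 * (z ^+ 4) ^+ gaps x.2.
rewrite (eq_bigr (fun f => g (quot_bits M K (fvals f)))) => [|f _]; last first.
  by rewrite /rank5 exprD exprM.
rewrite (sum_part_codes nM MK aE bE) big_filter /=.
(* In this case the weight equation has no solution, so no pair of words qualifies. *)
have [Ta|odd_case] := boolP (odd (n + 'C(M.*2, 2) - b) || (n + 'C(M.*2, 2) < b)%N).
  apply: big_pred0 => x; apply/negP => /and3P[_ _ /eqP e].
  by move: Ta; rewrite -e addnK odd_double /= ltnNge leq_addl.
move: odd_case; rewrite negb_or -leqNgt => /andP[/even_halfK Te leb].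
move: _./2 Te => T Te.
rewrite (eq_bigl (fun x : bitseq * bitseq =>
  [&& count id x.1 == a, count id x.2 == b & wsum x.1 + wsum x.2 == T]%N)); last first.
  by move=> [u v] /=; congr [&& _, _ & _]; apply/eqP/eqP => e; lia.
rewrite -bitpoly_coefM.
have Ma := bin2Z a; have Mb := bin2Z b; have MM := bin2Z M.*2.
have TE : 2 * T%:Z + b%:Z = n%:Z + ('C(M.*2, 2))%:Z by lia.
(* Below the least weight C(a, 2) + C(b, 2) the coefficient is 0. *)
have [lt|le] := ltnP T ('C(a, 2) + 'C(b, 2))%N.
  by rewrite bitpoly_mulE coefXnM lt.
rewrite -(subnKC le); set N := (T - _)%N.
(* From C(a, 2) + C(b, 2) = M^2 + j^2 - M and C(2M, 2) = 2M^2 - M. *)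
have NE : n%:Z = 2 * N%:Z + 2 * j * j - j.
  have NT : N%:Z = T%:Z - ('C(a, 2))%:Z - ('C(b, 2))%:Z by lia.
  have {}Ma : 2 * ('C(a, 2))%:Z = M%:Z * M%:Z + 2 * (M%:Z * j) + j * j - M%:Z - j.
    by rewrite Ma aE; ring.
  have {}Mb : 2 * ('C(b, 2))%:Z = M%:Z * M%:Z - 2 * (M%:Z * j) + j * j - M%:Z + j.
    by rewrite Mb bE; ring.
  have {}MM : 2 * ('C(M.*2, 2))%:Z = 4 * (M%:Z * M%:Z) - 2 * M%:Z.
    have -> : 4 * (M%:Z * M%:Z) - 2 * M%:Z = (2 * M%:Z) * (2 * M%:Z) - 2 * M%:Z by ring.
    by rewrite MM -mul2n PoszM.
  have -> : 2 * j * j = 2 * (j * j) by ring.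
  by move: (j * j) (M%:Z * M%:Z) (M%:Z * j) Ma Mb MM => jj MM' Mj; lia.
have Nn : (N <= n)%N.
  have j2 : 0 <= j * j by rewrite -expr2 sqr_ge0.
  have jj : j <= j * j.
    by have [j0|j0] := lerP j 0; [exact: le_trans j0 j2 | apply: ler_peMl; lia].
  have e : 2 * j * j = 2 * (j * j) by ring.
  by rewrite e in NE; lia.
have N5 := hN N NE.
clear -aE bE Nn N5 z5 z1 F2.
apply: bitpoly_coef => //; rewrite /K /M /rank_shift /rank_width in aE bE *; lia.
Qed.

Lemma two_quot_rank_mod5 (j : int) (n m : nat) (f : {ffun 'I_n -> 'I_n.+1}) :
  (m < 5)%N -> is_part_code f ->
  `[< exists r : int, two_quot_rank_is (parts_of f) r /\ (r = m%:Z %[mod 5])%Z >]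
  = (rank5 j f %% 5 == m)%N.
Proof.
move=> m5 /andP[sf _]; set M := rank_shift j n; set K := rank_width j n.
have szf : (size (fvals f) <= M.*2)%N by rewrite size_fvals /M /rank_shift; lia.
have MK : (n + M.*2 <= K.*2)%N by rewrite /M /K /rank_shift /rank_width; lia.
have bound x := @part_code_bound n M K MK f x sf.
have nu0 := @nu_hat_is_gaps _ _ _ sf szf bound 0%N isT.
have nu1 := @nu_hat_is_gaps _ _ _ sf szf bound 1%N isT.
rewrite /rank5 -/M -/K /=; apply/asboolP/eqP => [[r [[N0 [N1 [h0 h1 ->]]]]]|e].
  rewrite (nu_hat_is_inj h0 nu0) (nu_hat_is_inj h1 nu1); lia.
exists ((gaps (halfbits K 0 (beta M (fvals f))))%:Z - (gaps (halfbits K 1 (beta M (fvals f))))%:Z).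
split; last lia.
by exists (gaps (halfbits K 0 (beta M (fvals f)))), (gaps (halfbits K 1 (beta M (fvals f)))).
Qed.

(** Orthogonality of the characters of Z/5: the trivial one yields [pbar], and [twisted_sum] kills
    the other four. *)
Lemma Pbar5_equidistributed (j : int) (n m : nat) : (m < 5)%N ->
  (forall N : nat, n%:Z = 2 * N%:Z + 2 * j * j - j -> (N %% 5)%N \in [:: 2; 3; 4]%N) ->
  (Pbar5 j m n)%:R = (pbar j n)%:R / 5 :> rat.
Proof.
move=> m5 hN.
suff e : (5 * Pbar5 j m n = pbar j n)%N.
  by rewrite -e natrM mulrC mulrA mulVf ?mul1r.
have [z pz] := C_prim_root_exists (isT : (0 < 5)%N).
have z5 : z ^+ 5 = 1 := prim_expr_order pz.
have zE k : (z ^+ k == 1) = (5 %| k)%N by rewrite -(prim_order_dvd pz).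
have charC : (2%:R : algC) != 0 by rewrite pnatr_eq0.
apply/eqP; rewrite -(eqr_nat algC) natrM; apply/eqP.
have -> : (pbar j n)%:R = \sum_(f in part_codes j n) 1 :> algC by rewrite sumr_const.
have -> : (Pbar5 j m n)%:R = \sum_(f in part_codes j n) (rank5 j f %% 5 == m)%N%:R :> algC.
  rewrite -natr_sum /Pbar5 -sum1_card; congr (_%:R).
  rewrite [RHS]big_mkcond [LHS]big_mkcond; apply: eq_bigr => f _.
  rewrite !inE; case: (boolP (is_part_code f)) => //= pf.
  by rewrite (two_quot_rank_mod5 j m5 pf); case: (_ == j); case: (_ == m).
rewrite big_distrr /=.
(* The exponent r + 4m represents r - m modulo 5. *)
transitivity (\sum_(f in part_codes j n) \sum_(k < 5) (z ^+ k) ^+ (rank5 j f + 4 * m)).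
  apply: eq_bigr => f _; under eq_bigr do rewrite exprAC.
  rewrite !big_ord_recr big_ord0 /= add0r expr0 expr1.
  set r := rank5 j f; have -> : (r %% 5 == m)%N = (z ^+ (r + 4 * m) == 1) by rewrite zE; lia.
  have y5 : (z ^+ (r + 4 * m)) ^+ 5 = 1 by rewrite exprAC z5 expr1n.
  case: eqVneq => [->|y1]; first by rewrite !expr1n mulr1; ring.
  by rewrite (sum_fifth_root y5 y1) mulr0.
rewrite exchange_big big_ord_recl /= [X in _ + X]big1 ?addr0.
  by apply: eq_bigr => f _; rewrite expr0 expr1n.
move=> k _; under eq_bigr do rewrite exprD.
rewrite -big_distrl /= twisted_sum ?mul0r //.
- by rewrite exprAC z5 expr1n.
- by rewrite zE /bump; case: k => -[|[|[|[|k]]]].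
Qed.

Theorem theorem5 (j : int) (n : nat) (m : nat) (hm : (m < 5)%N) :
  [/\ ((j %% 5)%Z \in [:: 1; 2]) ->
        (Pbar5 j m (5 * n)%N)%:R = (pbar j (5 * n)%N)%:R / 5 :> rat,
      ((j %% 5)%Z \notin [:: 1; 2]) ->
        (Pbar5 j m (5 * n).+1)%:R = (pbar j (5 * n).+1)%:R / 5 :> rat,
      ((j %% 5)%Z \notin [:: 0; 3]) ->
        (Pbar5 j m (5 * n).+2)%:R = (pbar j (5 * n).+2)%:R / 5 :> rat,
      ((j %% 5)%Z \in [:: 0; 3]) ->
        (Pbar5 j m (5 * n).+3)%:R = (pbar j (5 * n).+3)%:R / 5 :> rat
    & (Pbar5 j m (5 * n).+4)%:R = (pbar j (5 * n).+4)%:R / 5 :> rat].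
Proof.
set r := (j %% 5)%Z.
have r5 : r = 0 \/ r = 1 \/ r = 2 \/ r = 3 \/ r = 4 by rewrite /r; lia.
(* Modulo 5, 2j^2 - j depends only on the residue r of j; each r then turns the class of n into a
   class of N. *)
have [Q QE] : exists Q : int, 2 * j * j - j = 5 * Q + 2 * r * r - r.
  exists (10 * (j %/ 5)%Z * (j %/ 5)%Z + 4 * (j %/ 5)%Z * r - (j %/ 5)%Z).
  by rewrite {1 2 3}(divz_eq j 5) -/r; ring.
move: r r5 QE => r r5 QE.
split=> [jr|jr|jr|jr|]; apply: Pbar5_equidistributed => // N; rewrite -addrA QE => NE;
  rewrite !inE; try rewrite !inE in jr;
  clear QE; case: r5 => [|[|[|[|]]]] r_; rewrite r_ in NE; lia.
Qed.
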